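(* Let $T$ be the Tutte graph. There exists a set $N$ of twelve vertices of $T$ such that, designating the vertices of $N$ as negative and all other vertices as positive, $T$ has no 2-factor $F$ in which every cycle of $F$ contains an even number of positive vertices.
   Context: The Tutte graph is the classical 3-connected cubic planar non-Hamiltonian graph on 46 vertices, obtained from $K_4$ by replacing three of its four vertices by copies of Tutte's fragment. A 2-factor of a graph is a spanning subgraph in which every vertex has degree 2. *)

(* Defs.v *)
From mathcomp Require Import all_boot.

Set Implicit Arguments.
Unset Strict Implicit.
Unset Printing Implicit Defensive.

(* Tutte's fragment on {0, ..., 14}, each edge listed once.  Its outer cycle
   is 0 1 2 3 4 5 6 7 8.  The only vertices of degree 2 are 0, 4 and 6: they
   carry the three edges leaving the fragment, the edge at 0 being the one
   that every Hamiltonian cycle of an ambient graph is forced to use. *)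
Definition fragment_edges : seq (nat * nat) :=
  [:: (0, 1); (1, 2); (2, 3); (3, 4); (4, 5); (5, 6); (6, 7); (7, 8); (8, 0);
      (9, 10); (10, 11); (11, 12); (12, 13); (13, 9);
      (2, 9); (3, 10); (5, 11); (7, 12); (13, 14); (1, 14); (8, 14)].

Definition fragment_adj (u v : nat) : bool :=
  ((u, v) \in fragment_edges) || ((v, u) \in fragment_edges).

(* [None] is the vertex of K4 that is not replaced; [Some (i, u)] is vertex u
   in the fragment copy that replaces the i-th of the three other vertices. *)
Definition tutte_vertex : finType := option ('I_3 * 'I_15).

(* The copies are placed with the threefold rotational symmetry of the Tutte
   graph: the unreplaced vertex is joined to vertex 0 of each copy, and
   vertex 6 of each copy to vertex 4 of the next one. *)
Definition tutte : rel tutte_vertex := fun x y =>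
  match x, y with
  | None, None => false
  | None, Some (_, u) | Some (_, u), None => u == 0 :> nat
  | Some (i, u), Some (j, v) =>
      [|| (i == j) && fragment_adj u v,
          [&& j == ordS i, u == 6 :> nat & v == 4 :> nat]
        | [&& i == ordS j, v == 6 :> nat & u == 4 :> nat]]
  end.

Lemma tutte_sym : symmetric tutte.
Proof.
move=> [[i u]|] [[j v]|] //=.
by rewrite [j == i]eq_sym /fragment_adj [X in (_ && X) || _]orbC [X in _ || X]orbC.
Qed.

Lemma tutte_irrefl : irreflexive tutte.
Proof.
move=> [[i u]|] //=.
by case: i => [[|[|[|?]]]] // ?; case: u; do 15 (case=> //).
Qed.

Lemma card_tutte_vertex : #|tutte_vertex| = 46.
Proof. by rewrite card_option card_prod !card_ord. Qed.

Lemma tutte_cubic (x : tutte_vertex) : #|[set y | tutte x y]| = 3.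
Proof.
pose adj i u j v :=
  [|| (i == j) && fragment_adj u v,
      [&& j == i.+1 %% 3, u == 6 & v == 4]
    | [&& i == j.+1 %% 3, v == 6 & u == 4]].
have cardE' : #|[set y | tutte x y]| =
    tutte x None + \sum_(j < 3) \sum_(v < 15) tutte x (Some (j, v)).
  rewrite pair_bigA -sum1_card big_mkcond (bigD1 None) // inE.
  congr (_ + _).
  rewrite (reindex_onto (fun p => Some p) (odflt (ord0, ord0))) => [|[]] //.
  apply: eq_big => [p|[j v] _]; first by rewrite eqxx.
  by rewrite inE; case: (tutte x _).
rewrite {}cardE'; case: x => [[i u]|].
  rewrite (eq_bigr (fun j : 'I_3 => \sum_(0 <= v < 15) adj i u j v)); last first.
    by move=> j _; rewrite big_mkord.
  rewrite -(big_mkord predT (fun j => \sum_(0 <= v < 15) adj i u j v)) unlock.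
  by case: i => [[|[|[|?]]]] // ?; case: u; do 15 (case=> [?|]; first by vm_compute).
have hub (j : 'I_3) : \sum_(v < 15) tutte None (Some (j, v)) = 1.
  by rewrite /= -(big_mkord predT (fun v => nat_of_bool (v == 0))) unlock.
by under eq_bigr do rewrite hub; rewrite sum1_card card_ord.
Qed.

(* Simple graphs are symmetric irreflexive relations on a finite type, and a
   spanning subgraph is a subrelation on the same type. *)
Definition two_factor (V : finType) (e F : rel V) : Prop :=
  [/\ symmetric F, subrel F e & forall x, #|[set y | F x y]| = 2].

(* MathComp's [ucycle] also accepts [:: x; y] for any edge {x, y}, as well as
   the empty sequence; the bound on the size excludes them. *)
Definition is_cycle_of (V : finType) (F : rel V) (c : seq V) : Prop :=
  2 < size c /\ ucycle F c.

(* Main.v *)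
Require Import Defs.
From mathcomp Require Import all_boot.

Set Implicit Arguments.
Unset Strict Implicit.
Unset Printing Implicit Defensive.

(** Twelve negative vertices are taken by choosing the same four in each
    fragment.  A 2-factor misses one of the three edges at the hub; consider
    the fragment at that edge.  The complement of the 2-factor is a perfect
    matching, and only eight matchings of the fragment are compatible with the
    missed edge: two of them leave a Hamiltonian cycle of the fragment, which
    has 15 - 4 positive vertices, and each of the other six leaves a shorter
    cycle inside the fragment, odd for the chosen four negative vertices. *)

(** Chosen to meet each even-length list of [odd_cycles] in an odd number of vertices and each
    odd-length one in an even number. *)
Definition negatives : seq nat := [:: 0; 2; 4; 7].

Definition negative_vertices : {set tutte_vertex} :=
  [set x | if x is Some (_, u) then val u \in negatives else false].

(* One cycle for each of the eight matchings. *)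
Definition odd_cycles : seq (seq nat) :=
  [:: [:: 0; 1; 14; 8];
      [:: 2; 3; 10; 9];
      [:: 0; 1; 14; 13; 12; 7; 8];
      [:: 0; 1; 2; 9; 13; 14; 8];
      [:: 0; 1; 2; 3; 10; 9; 13; 14; 8];
      [:: 0; 1; 14; 13; 9; 2; 3; 10; 11; 12; 7; 8];
      [:: 0; 1; 14; 13; 12; 11; 10; 9; 2; 3; 4; 5; 6; 7; 8];
      [:: 0; 1; 2; 3; 4; 5; 6; 7; 12; 11; 10; 9; 13; 14; 8]].

Lemma odd_cyclesP (c : seq nat) : c \in odd_cycles ->
  [/\ 2 < size c, uniq c, {subset c <= iota 0 15}
    & odd (count (predC [in negatives]) c)].
Proof.
have: all (fun c => [&& 2 < size c, uniq c, all [in iota 0 15] c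
                      & odd (count (predC [in negatives]) c)]) odd_cycles by [].
by move=> /allP H /H /and4P[? ? /allP].
Qed.

(* Vertices 4 and 6 may have degree 1, because [f] omits the edges that leave
   the fragment; the degree 2 of vertex 0 says that its outer edge is unused. *)
Lemma fragment_odd_cycle (f : rel nat) :
    symmetric f -> {in iota 0 15 &, forall u v, f u v -> fragment_adj u v} ->
    (forall u, u < 15 ->
       count (f u) (iota 0 15) <= 2 <= count (f u) (iota 0 15) + (u \in [:: 4; 6])) ->
  exists2 c, c \in odd_cycles & cycle f c.
Proof.
move=> fC f_adj degf; apply/hasP.
(* Counting over fragment neighbours only, each degree evaluates to a sum of two or three
   booleans. *)
have deg u : u < 15 ->
    let d := count (f u) [seq v <- iota 0 15 | fragment_adj u v] in
    d <= 2 <= d + (u \in [:: 4; 6]).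
  move=> ltu; rewrite count_filter.
  rewrite (@eq_in_count _ _ (f u)) => [|v v15 /=]; first exact: degf.
  by apply: andb_idr => /f_adj-> //; rewrite mem_iota.
(* The order is that of the case splits below: each split decides the edges still open at the next
   vertex, and [//] discards branches where its degree fails or a listed cycle has appeared. *)
move: (deg 0 isT) (deg 1 isT) (deg 8 isT) (deg 14 isT) (deg 2 isT) (deg 9 isT)
  (deg 13 isT) (deg 3 isT) (deg 7 isT) (deg 12 isT) (deg 10 isT) (deg 11 isT)
  (deg 5 isT) (deg 4 isT) (deg 6 isT).
(* Orienting every edge as in [fragment_edges] leaves one boolean per edge. *)
have sym_edges : all (fun p => f p.2 p.1 == f p.1 p.2) fragment_edges.
  by apply/allP=> p _; rewrite fC.
clear deg degf f_adj fC; move: sym_edges => /=; do 20 case/andP=> /eqP->.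
move=> /andP[/eqP-> _].
case: (f 0 1); case: (f 8 0) => // _.
case: (f 1 2); case: (f 1 14) => // _.
all: case: (f 7 8); case: (f 8 14) => // _.
all: case: (f 13 14) => // _.
all: case: (f 2 3); case: (f 2 9) => // _.
all: case: (f 9 10); case: (f 13 9) => // _.
all: case: (f 12 13) => // _.
all: case: (f 3 4); case: (f 3 10) => // _.
all: case: (f 6 7); case: (f 7 12) => // _.
all: case: (f 11 12) => // _.
all: case: (f 10 11) => // _.
all: case: (f 5 11) => // _.
all: by case: (f 4 5); case: (f 5 6).
Qed.

Lemma card_negative_vertices : #|negative_vertices| = 12.
Proof.
pose neg := [set u : 'I_15 | val u \in negatives].
have -> : negative_vertices = Some @: setX setT neg.
  apply/setP=> [[[i u]|]]; rewrite inE.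
    by rewrite (mem_imset _ _ (@Some_inj _)) !inE.
  by apply/esym/imsetP=> [[]].
rewrite (card_imset _ (@Some_inj _)) cardsX cardsT card_ord -sum1dep_card.
by rewrite -(big_mkord [in negatives] (fun=> 1)) unlock.
Qed.

Lemma two_factor_avoids_hub (F : rel tutte_vertex) : two_factor tutte F ->
  exists i, ~~ F None (Some (i, ord0)).
Proof.
case=> _ _ /(_ None) deg2; apply/existsP; rewrite -negb_forall.
apply/negP=> /forallP hubF.
have: [set Some (i, ord0) | i : 'I_3] \subset [set y | F None y].
  by apply/subsetP=> _ /imsetP[i _ ->]; rewrite inE.
move/subset_leq_card; rewrite deg2 card_imset ?card_ord //.
by move=> i j [].
Qed.

Section Fragment.

Variables (F : rel tutte_vertex) (i : 'I_3).
Hypotheses (factorF : two_factor tutte F) (hubF : ~~ F None (Some (i, ord0))).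

(** Faithful only for [u < 15]: [inord] sends larger numbers to 0. *)
Let copy (u : nat) : tutte_vertex := Some (i, inord u).
Let f : rel nat := relpre copy F.

Let copy_inj : {in iota 0 15 &, injective copy}.
Proof.
move=> u v; rewrite !mem_iota /= => ltu ltv [/(congr1 val)].
by rewrite /= !inordK.
Qed.

(** Edges leave the copy only at 0, 4 and 6, one at each; [hubF] rules out the one at 0. *)
Lemma fragment_degree (u : nat) : u < 15 ->
  count (f u) (iota 0 15) <= 2 <= count (f u) (iota 0 15) + (u \in [:: 4; 6]).
Proof.
case: factorF => FC F_sub deg2 ltu.
pose inner := [set y in map copy (iota 0 15) | F (copy u) y].
pose all_nbrs := [set y | F (copy u) y].
have inner_sub : inner \subset all_nbrs.
  by apply/subsetP=> y; rewrite !inE => /andP[].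
have -> : count (f u) (iota 0 15) = #|inner|.
  have -> : inner = [set:: map copy [seq v <- iota 0 15 | f u v]].
    by apply/setP=> y; rewrite !in_set andbC -mem_filter filter_map.
  rewrite cardsE (card_uniqP _) ?size_map ?size_filter //.
  rewrite map_inj_in_uniq ?filter_uniq ?iota_uniq // => v w.
  by rewrite !mem_filter => /andP[_ v15] /andP[_ w15]; apply: copy_inj.
have outer_le1 : #|all_nbrs :\: inner| <= (u \in [:: 4; 6]).
  (* The neighbour of 4 in the preceding copy, or of 6 in the next one; for other [u] the value is
     arbitrary. *)
  pose exit : tutte_vertex :=
    if u == 4 then Some (ord_pred i, inord 6) else Some (ordS i, inord 4).
  suff outer_exit y : y \in all_nbrs :\: inner -> (u \in [:: 4; 6]) && (y == exit).
    case: (u \in _) outer_exit => outer_exit.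
      rewrite -[nat_of_bool true](cards1 exit); apply: subset_leq_card.
      by apply/subsetP=> y /outer_exit; rewrite in_set1.
    by rewrite leqn0 cards_eq0; apply/set0Pn => -[y /outer_exit].
  rewrite !in_set => /andP[outer Fuy]; rewrite Fuy andbT in outer.
  have := F_sub _ _ Fuy.
  case: y outer Fuy => [[j v]|] outer Fuy; rewrite /= inordK //; last first.
    move=> /eqP u0; move: Fuy; rewrite FC u0 /copy.
    by rewrite (_ : inord 0 = ord0) ?(negPf hubF) //; apply: val_inj; rewrite /= inordK.
  case/or3P.
  - case/andP=> /eqP ij _; case/mapP: outer; exists (val v).
      by rewrite mem_iota /=.
    by rewrite /copy inord_val ij.
  - case/and3P=> /eqP-> /eqP u6 /eqP v4.
    by rewrite /exit u6 (_ : v = inord 4) ?eqxx //; apply: val_inj; rewrite /= v4 inordK.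
  - case/and3P=> /eqP ij /eqP v6 /eqP u4.
    rewrite /exit u4 (_ : v = inord 6) ?ij ?ordSK ?eqxx //.
    by apply: val_inj; rewrite /= v6 inordK.
move: (u \in _) outer_le1 (cardsID inner all_nbrs) => ext outer_le1.
by rewrite (setIidPr inner_sub) deg2 => <-; rewrite leq_addr leq_add2l.
Qed.

Lemma odd_positive_cycle :
  exists2 c, is_cycle_of F c & odd #|[set v in c | v \notin negative_vertices]|.
Proof.
case: (factorF) => FC F_sub _.
have f_adj : {in iota 0 15 &, forall u v, f u v -> fragment_adj u v}.
  move=> u v; rewrite !mem_iota /= => ltu ltv /F_sub /=.
  (* Rotating the three copies fixes none, so edges inside a copy come from the fragment. *)
  have -> : i == ordS i = false by case: (i) => [[|[|[|]]]].
  by rewrite !inordK // eqxx orbF.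
have [|c codd fc] := fragment_odd_cycle _ f_adj fragment_degree.
  by move=> u v; apply: FC.
have [csize cuniq csub cpos] := odd_cyclesP codd.
have Cuniq : uniq (map copy c).
  by rewrite map_inj_in_uniq // => u v /csub u15 /csub v15; apply: copy_inj.
exists (map copy c).
  by rewrite /is_cycle_of /ucycle size_map cycle_map Cuniq andbT.
have -> : [set v in map copy c | v \notin negative_vertices]
          = [set:: filter (fun v => v \notin negative_vertices) (map copy c)].
  by apply/setP=> v; rewrite [LHS]in_set [RHS]in_set mem_filter andbC.
rewrite cardsE (card_uniqP _) ?filter_uniq // size_filter count_map.
rewrite (@eq_in_count _ _ (predC [in negatives])) // => u /csub.
by rewrite mem_iota /= => ltu; rewrite in_set /= inordK.
Qed.

End Fragment.

Theorem theorem3 :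
  exists N : {set tutte_vertex},
    #|N| = 12 /\
    ~ (exists F : rel tutte_vertex,
         two_factor tutte F /\
         (forall c : seq tutte_vertex, is_cycle_of F c ->
            ~~ odd #|[set v in c | v \notin N]|)).
Proof.
exists negative_vertices; split; first exact: card_negative_vertices.
case=> F [factorF evenF].
have [i hubF] := two_factor_avoids_hub factorF.
have [c /evenF/negP] := odd_positive_cycle factorF hubF.
exact.
Qed.
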